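(* Let $B$ be a real-valued function of $CZ$ with $1-\mathbb{E}_\nu(B(CZ))\ge\max_{dz}\nu(d|z)$ for all $\nu\in\mathcal{C}_{C|Z}\rtimes\mathrm{Unif}_Z$, let $\rho_{C|Z}\in\mathcal{C}_{C|Z}$ with $\bar b=\mathbb{E}_{\rho_{C|Z}\rtimes\mathrm{Unif}_Z}(B)>0$, and for $0<r<1/2$ and $\beta>0$ let $$F_{r,\beta}(CZT)=(1-\bar b)^{-\beta}\left(1+\beta\frac{B_r(CZT)-\bar b}{1-\bar b}\right),\qquad B_r(CZ0)=0,\quad B_r(CZ1)=B(CZ)\frac1r .$$ There exist constants $d>0$, $d'\ge0$ independent of $r$ such that for $0<\beta\le dr$, $F_{r,\beta}$ is a PEF with power $\beta$ for $\mathcal{C}_{C|ZT}\rtimes\nu_r$, and its log-prob rate $g_{r,\beta}$ at $\tilde\rho_{C|ZT}\rtimes\nu_r$ satisfies $g_{r,\beta}\ge-\log(1-\bar b)-d'\beta/r$.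
   Context: All random variables have finite value spaces; $\mathrm{Rng}(X)$ is the value space of $X$, $\mathrm{Unif}_Z$ the uniform distribution on $\mathrm{Rng}(Z)$. $D$ is a function of $C$ (in $\max_{dz}\nu(d|z)$, $d$ ranges over values of $D$; this $d$ is unrelated to the constant $d$). Logarithms are natural; expectations are sums over values of positive probability only. $\mathcal{C}_{C|Z}$ is a fixed closed convex set of families $(\rho_{C|z})_{z\in\mathrm{Rng}(Z)}$ of distributions of $C$. For such a family and a distribution $\nu$ of $Z$, $(\rho_{C|Z}\rtimes\nu)(cz)=\rho_{C|z}(c)\nu(z)$; $\mathcal{C}_{C|Z}\rtimes\nu=\{\rho_{C|Z}\rtimes\nu:\rho_{C|Z}\in\mathcal{C}_{C|Z}\}$. $T\in\{0,1\}$ is a test bit appended to $Z$. For $\rho_{C|Z}\in\mathcal{C}_{C|Z}$ let $\tilde\rho_{C|zt}=\rho_{C|z}$ for all $z,t$, and $\mathcal{C}_{C|ZT}=\{\tilde\rho_{C|ZT}:\rho_{C|Z}\in\mathcal{C}_{C|Z}\}$; $\rtimes$ is used analogously for $ZT$. Let $q=1/|\mathrm{Rng}(Z)|$ and fix a value $z_0$ of $Z$. For $0<r<1/2$, $\nu_r$ is the distribution of $ZT$ with $\nu_r(z1)=rq$ and $\nu_r(z0)=1-r$ if $z=z_0$, $0$ otherwise. PEF: a probability estimation factor with power $\beta>0$ for a set $\mathcal{C}$ of distributions of $CZT$ (and $D|ZT$) is a non-negative function $F(CZT)$ with $\mathbb{E}_\sigma(F(CZT)\sigma(D|ZT)^\beta)\le1$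 for all $\sigma\in\mathcal{C}$. Its log-prob rate at a distribution $\sigma$ is $\mathbb{E}_\sigma(\log F(CZT))/\beta$. *)

(* Defs.v *)
From mathcomp Require Import all_boot all_order all_algebra.
From mathcomp Require Import all_classical all_reals all_analysis.
Set Implicit Arguments.
Unset Strict Implicit.
Unset Printing Implicit Defensive.
Import Order.TTheory GRing.Theory Num.Theory.
Import numFieldNormedType.Exports.
Local Open Scope classical_set_scope.
Local Open Scope ring_scope.

(* A finite-valued random variable is represented by its value space, a
   finType; a distribution by its probability mass function; and a variable D
   that is a function of C by a map f : C -> D. *)

Definition is_distr (R : realType) (X : finType) (p : X -> R) : Prop :=
  (forall x, 0 <= p x) /\ \sum_x p x = 1.

Definition Ex (R : realType) (X : finType) (s g : X -> R) : R :=
  \sum_(x | 0 < s x) s x * g x.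

Definition uniform_distr (R : realType) (X : finType) : X -> R :=
  fun _ => #|X|%:R^-1.

(* The conditional probability s(d|w).  When s(w) = 0 it takes the junk value
   0, which contributes neither to Ex nor to max_cond. *)
Definition cond (R : realType) (C D W : finType) (f : C -> D)
    (s : C * W -> R) (d : D) (w : W) : R :=
  (\sum_(c | f c == d) s (c, w)) / \sum_c s (c, w).

(* The base value 0 of the iterated maximum is harmless, since conditional
   probabilities are nonnegative. *)
Definition max_cond (R : realType) (C D W : finType) (f : C -> D)
    (s : C * W -> R) : R :=
  \big[Num.max/0]_(dw : D * W) cond f s dw.1 dw.2.

Definition rtimes (R : realType) (C W : finType)
    (rho : W -> C -> R) (nu : W -> R) : C * W -> R :=
  fun cw => rho cw.2 cw.1 * nu cw.2.

Definition rtimes_set (R : realType) (C W : finType)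
    (CC : set (W -> C -> R)) (nu : W -> R) : set (C * W -> R) :=
  [set rtimes rho nu | rho in CC].

(* Closedness is in the Euclidean topology of R^(Z x C), i.e. that of
   pointwise convergence. *)
Definition closed_convex_families (R : realType) (C Z : finType)
    (CC : set (Z -> C -> R)) : Prop :=
  [/\ forall rho, CC rho -> forall z, is_distr (rho z),
      closed (CC : set {ptws Z -> {ptws C -> R}})
    & convex_set CC].

(* The test bit T ranges over bool, with T = 1 encoded as true. *)
Definition tilde (R : realType) (C Z : finType) (rho : Z -> C -> R) :
    Z * bool -> C -> R :=
  fun zt => rho zt.1.

Definition tilde_set (R : realType) (C Z : finType) (CC : set (Z -> C -> R)) :
    set (Z * bool -> C -> R) :=
  [set tilde rho | rho in CC].

Definition nu_test (R : realType) (Z : finType) (z0 : Z) (r : R) :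
    Z * bool -> R :=
  fun zt => if zt.2 then r * #|Z|%:R^-1
            else if zt.1 == z0 then 1 - r else 0.

Definition is_PEF (R : realType) (C D W : finType) (f : C -> D) (beta : R)
    (S : set (C * W -> R)) (F : C * W -> R) : Prop :=
  [/\ 0 < beta,
      forall cw, 0 <= F cw
    & forall s, S s ->
        Ex s (fun cw => F cw * cond f s (f cw.1) cw.2 `^ beta) <= 1].

(* Extended-real valued: lne 0 = -oo, so a zero of F in the support of s gives
   rate -oo instead of being hidden by ln 0 = 0. *)
Definition log_prob_rate (R : realType) (X : finType) (beta : R)
    (s F : X -> R) : \bar R :=
  ((\sum_(x | (0 < s x)%R) (s x)%:E * lne (F x)%:E) * (beta^-1)%:E)%E.

Definition B_test (R : realType) (C Z : finType) (B : C * Z -> R) (r : R) :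
    C * (Z * bool) -> R :=
  fun czt => if czt.2.2 then B (czt.1, czt.2.1) * r^-1 else 0.

Definition F_test (R : realType) (C Z : finType) (B : C * Z -> R)
    (bbar r beta : R) : C * (Z * bool) -> R :=
  fun czt => (1 - bbar) `^ (- beta)
             * (1 + beta * ((B_test B r czt - bbar) / (1 - bbar))).

(* Main.v *)
(** Let [b] be the expectation of [B] at an arbitrary member of the set with
    uniform inputs.  Testing with [nu_r] rescales so that [B_r] has expectation
    [b] as well, and conditional probabilities given inputs do not depend on the
    input distribution, so they are at most [1 - b].  With [u = (b - bbar) / (1 - bbar)] we have
    [1 - b = (1 - u) (1 - bbar)], hence the PEF expectation is at most
    [(1 - u)^beta (1 + beta u) <= exp (- beta u) exp (beta u) = 1].
    Let [|B| <= M].  For [beta <= d r] with [d = (1 - bbar) / (2 (M + 1))], the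
    relative deviation [x = beta (B_r - bbar) / (1 - bbar)] is at least [-1/2],
    so [F] is positive and [ln (1 + x) >= x - 2 x^2].  At [rho], [x] has mean
    [0], and [B_r] has second moment at most [M^2 / r], which gives the rate
    with [d' = 2 M^2 / (1 - bbar)^2]. *)
Require Import Defs.
From mathcomp Require Import all_boot all_order all_algebra.
From mathcomp Require Import all_classical all_reals all_analysis.
From mathcomp Require Import ring lra.
Set Implicit Arguments.
Unset Strict Implicit.
Unset Printing Implicit Defensive.
Import Order.TTheory GRing.Theory Num.Theory.
Import numFieldNormedType.Exports.
Local Open Scope classical_set_scope.
Local Open Scope ring_scope.

(** * Finite expectations *)

Lemma ExE (R : realType) (X : finType) (s g : X -> R) :
  (forall x, 0 <= s x) -> Ex s g = \sum_x s x * g x.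
Proof.
move=> s0; rewrite /Ex big_mkcond /=; apply: eq_bigr => x _.
case: ltP => // sx; suff -> : s x = 0 by rewrite mul0r.
by apply/eqP; rewrite eq_le sx s0.
Qed.

Lemma ler_Ex (R : realType) (X : finType) (s g h : X -> R) :
  (forall x, 0 < s x -> g x <= h x) -> Ex s g <= Ex s h.
Proof. by move=> gh; apply: ler_sum => x sx; rewrite ler_pM2l ?gh. Qed.

Lemma ExD (R : realType) (X : finType) (s g h : X -> R) :
  Ex s (fun x => g x + h x) = Ex s g + Ex s h.
Proof. by rewrite /Ex -big_split; apply: eq_bigr => x _; rewrite mulrDr. Qed.

Lemma ExZ (R : realType) (X : finType) (s g : X -> R) (a : R) :
  Ex s (fun x => a * g x) = a * Ex s g.
Proof. by rewrite /Ex mulr_sumr; apply: eq_bigr => x _; rewrite mulrCA. Qed.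

Lemma Ex_cst (R : realType) (X : finType) (s : X -> R) (a : R) :
  is_distr s -> Ex s (fun=> a) = a.
Proof. by case=> s0 s1; rewrite ExE// -mulr_suml s1 mul1r. Qed.

Lemma sum_pair (V : nmodType) (I J : finType) (G : I * J -> V) :
  \sum_x G x = \sum_i \sum_j G (i, j).
Proof.
by rewrite (pair_bigA _ (fun i j => G (i, j))); apply: eq_bigr => -[].
Qed.

(** * Product distributions and test inputs *)

Lemma rtimes_distr (R : realType) (C W : finType) (rho : W -> C -> R)
    (nu : W -> R) :
  (forall w, is_distr (rho w)) -> is_distr nu -> is_distr (rtimes rho nu).
Proof.
move=> rhoP [nu0 nu1]; split=> [[c w]|].
  by rewrite mulr_ge0//; case: (rhoP w).
rewrite -nu1 sum_pair exchange_big /=.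
by apply: eq_bigr => w _; rewrite /rtimes /= -mulr_suml (rhoP w).2 mul1r.
Qed.

Lemma uniform_distrP (R : realType) (Z : finType) (z0 : Z) :
  is_distr (@uniform_distr R Z).
Proof.
split=> [z|]; first by rewrite invr_ge0 ler0n.
rewrite /uniform_distr sumr_const -[LHS]mulr_natr mulVf//.
by rewrite pnatr_eq0 -lt0n; apply/card_gt0P; exists z0.
Qed.

Lemma big_prod_bool (R : realType) (Z : finType) (G : Z * bool -> R) :
  \sum_zt G zt = \sum_z (G (z, true) + G (z, false)).
Proof.
by rewrite sum_pair; apply: eq_bigr => z _; rewrite big_bool.
Qed.

Lemma nu_test_distr (R : realType) (Z : finType) (z0 : Z) (r : R) :
  0 <= r <= 1 -> is_distr (nu_test z0 r).
Proof.
move=> /andP[r0 r1]; split=> [[z [|]]|]; rewrite /nu_test /=.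
- by rewrite mulr_ge0// invr_ge0.
- by case: ifP => // _; rewrite subr_ge0.
rewrite big_prod_bool big_split /= -mulr_sumr.
rewrite (uniform_distrP R z0).2 mulr1 -big_mkcond big_pred1_eq.
by rewrite addrC subrK.
Qed.

(** Only the branch [T = 1] contributes, and there [nu_test] is [r] times the uniform
    distribution. *)
Lemma Ex_nu_test (R : realType) (C Z : finType) (z0 : Z) (rho : Z -> C -> R)
    (r : R) (G : C * (Z * bool) -> R) :
    (forall z, is_distr (rho z)) -> 0 <= r <= 1 ->
    (forall c z, G (c, (z, false)) = 0) ->
  Ex (rtimes (tilde rho) (nu_test z0 r)) G =
  r * Ex (rtimes rho (@uniform_distr R Z)) (fun cz => G (cz.1, (cz.2, true))).
Proof.
move=> rhoP r01 G0.
have [s0 _] := rtimes_distr (fun zt => rhoP zt.1) (nu_test_distr z0 r01).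
have [u0 _] := rtimes_distr rhoP (uniform_distrP R z0).
rewrite !ExE// !sum_pair mulr_sumr; apply: eq_bigr => c _.
rewrite mulr_sumr big_prod_bool; apply: eq_bigr => z _.
rewrite G0 mulr0 addr0 /rtimes /tilde /nu_test /uniform_distr /=.
ring.
Qed.

Lemma Ex_B_test (R : realType) (C Z : finType) (z0 : Z) (rho : Z -> C -> R)
    (B : C * Z -> R) (r : R) :
    (forall z, is_distr (rho z)) -> 0 < r <= 1 ->
  Ex (rtimes (tilde rho) (nu_test z0 r)) (B_test B r) =
  Ex (rtimes rho (@uniform_distr R Z)) B.
Proof.
move=> rhoP /andP[r0 r1]; rewrite Ex_nu_test//=; last by rewrite r1 ltW.
rewrite -ExZ; apply: eq_bigr => -[c z] _.
by rewrite /B_test /= [r * _]mulrC mulfVK// gt_eqF.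
Qed.

(** The input weight [nu w] cancels, so a bound proved for uniform inputs carries over to
    [nu_test]. *)
Lemma cond_rtimes (R : realType) (C D W : finType) (f : C -> D)
    (rho : W -> C -> R) (nu : W -> R) (d : D) (w : W) :
    is_distr (rho w) -> nu w != 0 ->
  cond f (rtimes rho nu) d w = \sum_(c | f c == d) rho w c.
Proof.
by move=> [_ rho1] nuw; rewrite /cond /rtimes /= -!mulr_suml rho1 mul1r mulfK.
Qed.

Lemma cond_le_max (R : realType) (C D W : finType) (f : C -> D)
    (s : C * W -> R) (d : D) (w : W) : cond f s d w <= max_cond f s.
Proof.
exact: (le_bigmax _ (fun dw : D * W => cond f s dw.1 dw.2) (d, w)).
Qed.

(** Some [c] has positive probability given [w], hence so has [f c]. This yields [b < 1] and
    [bbar < 1] from the assumption on [B]. *)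
Lemma max_cond_gt0 (R : realType) (C D W : finType) (f : C -> D)
    (rho : W -> C -> R) (nu : W -> R) (w : W) :
  is_distr (rho w) -> nu w != 0 -> 0 < max_cond f (rtimes rho nu).
Proof.
move=> rhoP nuw; have [rho0 rho1] := rhoP.
have [c rc] : exists c, 0 < rho w c.
  apply/existsP/contraT; rewrite negb_exists => /forallP rle.
  have := oner_neq0 R; rewrite -rho1 big1 ?eqxx// => c _.
  by apply/eqP; rewrite eq_le rho0 leNgt rle.
apply: lt_le_trans (cond_le_max f _ (f c) w); rewrite cond_rtimes//.
by rewrite (bigD1 c)//= ltr_pwDl// sumr_ge0.
Qed.

(** * Two inequalities for powers and logarithms *)

Lemma powR_mul_affine_le1 (R : realType) (u beta : R) :
    0 < 1 - u -> 0 <= beta -> 0 <= 1 + beta * u ->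
  (1 - u) `^ beta * (1 + beta * u) <= 1.
Proof.
move=> u1 b0 bu; rewrite /powR gt_eqF//.
rewrite [leRHS](_ : 1 = expR (- (beta * u)) * expR (beta * u)); last first.
  by rewrite -expRD addNr expR0.
apply: ler_pM; [exact: expR_ge0|exact: bu| |exact: expR_ge1Dx].
rewrite ler_expR -mulrN ler_wpM2l//.
by have := le_ln1Dx (x := - u); rewrite ltrN2; apply; lra.
Qed.

(** Applying [ln y <= y - 1] to [y = 1 / (1 + x)] gives [ln (1 + x) >= 1 - 1 / (1 + x)]. This
    exceeds the claimed bound by [x^2 (1 + 2 x) / (1 + x)], which is nonnegative for [x >= -1/2]. *)
Lemma ln1Dx_ge (R : realType) (x : R) :
  - 2^-1 <= x -> x - 2 * x ^+ 2 <= ln (1 + x).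
Proof.
move=> hx; have x1 : 0 < 1 + x by lra.
have /le_ln1Dx : -1 < (1 + x)^-1 - 1 by rewrite ltrBrDr addNr invr_gt0.
rewrite addrC subrK lnV ?posrE// => h.
apply: (@le_trans _ _ (1 - (1 + x)^-1)); last by lra.
rewrite -subr_ge0.
have -> : 1 - (1 + x)^-1 - (x - 2 * x ^+ 2) = x ^+ 2 * (1 + 2 * x) / (1 + x).
  by field; rewrite gt_eqF.
by apply: divr_ge0 (ltW x1); apply: mulr_ge0; [exact: sqr_ge0|lra].
Qed.

(** * The PEF inequality *)

Lemma Ex_F_test (R : realType) (C Z : finType) (z0 : Z) (rho : Z -> C -> R)
    (B : C * Z -> R) (bbar r beta : R) :
    (forall z, is_distr (rho z)) -> 0 < r <= 1 ->
  Ex (rtimes (tilde rho) (nu_test z0 r)) (F_test B bbar r beta) =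
  (1 - bbar) `^ (- beta) *
  (1 + beta * ((Ex (rtimes rho (@uniform_distr R Z)) B - bbar) / (1 - bbar))).
Proof.
move=> rhoP r01; have /andP[r0 r1] := r01.
have nuP : is_distr (nu_test z0 r) by apply: nu_test_distr; rewrite r1 ltW.
have sP := rtimes_distr (fun zt => rhoP zt.1 : is_distr (tilde rho zt)) nuP.
(* [F_test] is affine in [B_test], so only the mean of [B_test] matters; [bbar] may differ from
   it. *)
transitivity (Ex (rtimes (tilde rho) (nu_test z0 r)) (fun x =>
    (1 - bbar) `^ (- beta) *
    (1 + beta / (1 - bbar) * (B_test B r x + - bbar)))).
  by apply: eq_bigr => x _; rewrite /F_test; ring.
rewrite ExZ ExD Ex_cst// ExZ ExD Ex_cst// Ex_B_test//.
by ring.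
Qed.

Lemma F_test_PEF (R : realType) (C Z D : finType) (f : C -> D) (z0 : Z)
    (CC : set (Z -> C -> R)) (B : C * Z -> R) (bbar r beta : R) :
    (forall rho, CC rho -> forall z, is_distr (rho z)) ->
    (forall nu, rtimes_set CC (@uniform_distr R Z) nu ->
       max_cond f nu <= 1 - Ex nu B) ->
    bbar < 1 -> 0 < r <= 1 -> 0 < beta ->
    (forall x, 0 <= F_test B bbar r beta x) ->
  is_PEF f beta (rtimes_set (tilde_set CC) (nu_test z0 r))
    (F_test B bbar r beta).
Proof.
move=> CCP hB bbar1 r01 beta0 F0; split=> // _ [_ [rho Crho <-] <-].
have rhoP := CCP _ Crho; have [u0 u1] := uniform_distrP R z0.
have unif_neq0 z : @uniform_distr R Z z != 0.
  by apply: contra_eq_neq u1 => uz; rewrite big1 ?(eq_sym 0) ?oner_eq0.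
set b := Ex (rtimes rho (@uniform_distr R Z)) B.
have max_b : max_cond f (rtimes rho (@uniform_distr R Z)) <= 1 - b.
  by apply: hB; exists rho.
have b1 : 0 < 1 - b.
  exact: lt_le_trans (max_cond_gt0 f (rhoP z0) (unif_neq0 z0)) max_b.
have bbar1' : 0 < 1 - bbar by rewrite subr_gt0.
have K0 : 0 < (1 - bbar) `^ (- beta) by exact: powR_gt0.
set s := rtimes _ _.
(* Replacing each conditional probability by the constant [1 - b] leaves only the expectation of
   [F_test] to compute. *)
apply: (@le_trans _ _
  (Ex s (fun x => (1 - b) `^ beta * F_test B bbar r beta x))).
  apply: ler_Ex => -[c zt] sx /=; rewrite mulrC; apply: ler_wpM2r => //.
  (* On the support of [s] the conditional probability is genuine, not the junk value [0]. *)
  have nu_neq0 : nu_test z0 r zt != 0.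
    by apply: contraTneq sx => nu0; rewrite /s /rtimes /= nu0 mulr0 ltxx.
  have condE : cond f s (f c) zt =
      cond f (rtimes rho (@uniform_distr R Z)) (f c) zt.1.
    by rewrite !cond_rtimes//; exact: rhoP.
  rewrite condE ge0_ler_powR ?nnegrE ?(ltW beta0) ?(ltW b1)//.
    by rewrite cond_rtimes// sumr_ge0// => c' _; case: (rhoP zt.1).
  exact: le_trans (cond_le_max _ _ _ _) max_b.
(* The sign of [1 + beta * u], required by [powR_mul_affine_le1], is read off from [F_test] having
   nonnegative expectation. *)
have EF0 : 0 <= Ex s (F_test B bbar r beta).
  by apply: sumr_ge0 => x sx; rewrite mulr_ge0 ?F0// ltW.
move: EF0; rewrite ExZ Ex_F_test// -/b pmulr_rge0// => uF0.
set u := (b - bbar) / (1 - bbar) in uF0 *.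
have bE : 1 - b = (1 - u) * (1 - bbar).
  by rewrite /u; field; rewrite gt_eqF.
have u1' : 0 < 1 - u by move: b1; rewrite bE pmulr_lgt0.
rewrite bE powRM ?(ltW u1') ?(ltW bbar1')// powRN mulrA.
rewrite mulfK ?gt_eqF ?powR_gt0//.
by apply: powR_mul_affine_le1 => //; exact: ltW.
Qed.

(** * The log-prob rate *)

Lemma log_prob_rateE (R : realType) (X : finType) (beta : R) (s F : X -> R) :
    (forall x, 0 < F x) ->
  log_prob_rate beta s F = (Ex s (fun x => ln (F x)) / beta)%:E.
Proof.
move=> F0; rewrite /log_prob_rate EFinM; congr (_ * _)%E.
by rewrite /Ex -sumEFin; apply: eq_bigr => x _; rewrite lne_EFin.
Qed.

(** The square is [B^2 / r^2] on tests and [0] elsewhere; the test probability [r] cancels one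
    factor [1 / r]. *)
Lemma Ex_B_test_sqr_le (R : realType) (C Z : finType) (z0 : Z)
    (rho : Z -> C -> R) (B : C * Z -> R) (r M : R) :
    (forall z, is_distr (rho z)) -> 0 < r <= 1 -> (forall x, `|B x| <= M) ->
  Ex (rtimes (tilde rho) (nu_test z0 r)) (fun x => B_test B r x ^+ 2) <=
  M ^+ 2 / r.
Proof.
move=> rhoP /andP[r0 r1] BM; rewrite Ex_nu_test//; last 2 first.
- by rewrite r1 ltW.
- by move=> c z; rewrite /B_test /= expr0n.
rewrite -ExZ; have uP := rtimes_distr rhoP (uniform_distrP R z0).
rewrite -(Ex_cst (M ^+ 2 / r) uP); apply: ler_Ex => -[c z] _.
rewrite /B_test /=.
have -> : r * (B (c, z) / r) ^+ 2 = B (c, z) ^+ 2 / r.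
  by field; rewrite gt_eqF.
rewrite ler_pM2r ?invr_gt0// -real_normK ?num_real//.
by rewrite lerXn2r ?nnegrE// (le_trans _ (BM (c, z))).
Qed.

Theorem theorem50 (R : realType) (C Z D : finType) (f : C -> D) (z0 : Z)
    (CC : set (Z -> C -> R)) (hCC : closed_convex_families CC)
    (B : C * Z -> R)
    (hB : forall nu, rtimes_set CC (@uniform_distr R Z) nu ->
       max_cond f nu <= 1 - Ex nu B)
    (rho : Z -> C -> R) (hrho : CC rho)
    (bbar : R) (hbbar : bbar = Ex (rtimes rho (@uniform_distr R Z)) B)
    (hbbar_gt0 : 0 < bbar) :
  exists d d' : R,
    [/\ 0 < d, 0 <= d' &
        forall r beta : R, 0 < r -> r < 1 / 2 -> 0 < beta -> beta <= d * r ->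
          is_PEF f beta (rtimes_set (tilde_set CC) (nu_test z0 r))
            (F_test B bbar r beta) /\
          ((- ln (1 - bbar) - d' * beta / r)%:E <=
           log_prob_rate beta (rtimes (tilde rho) (nu_test z0 r))
             (F_test B bbar r beta))%E].
Proof.
have [CCP _ _] := hCC; have rhoP := CCP _ hrho.
have [u0 u1] := uniform_distrP R z0.
have bbar1 : 0 < 1 - bbar.
  have max_b : max_cond f (rtimes rho (@uniform_distr R Z)) <= 1 - bbar.
    by rewrite hbbar; apply: hB; exists rho.
  apply: lt_le_trans max_b; apply: (max_cond_gt0 _ (w := z0)) => //.
  by apply: contra_eq_neq u1 => uz; rewrite big1 ?(eq_sym 0) ?oner_eq0.
pose M := \big[Num.max/0]_x `|B x|.
have BM x : `|B x| <= M by exact: (le_bigmax _ (fun x => `|B x|)).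
have M0 : 0 <= M by exact: bigmax_ge_id.
exists ((1 - bbar) / (2 * (M + 1))), (2 * M ^+ 2 / (1 - bbar) ^+ 2).
split.
- by apply: divr_gt0 => //; lra.
- by apply: divr_ge0 (sqr_ge0 _); apply: mulr_ge0 (sqr_ge0 M).
move=> r beta r0 r12 beta0 beta_le.
have r01 : 0 < r <= 1 by rewrite r0; lra.
have r01' : 0 <= r <= 1 by rewrite !ltW//; lra.
pose dev x := beta * ((B_test B r x - bbar) / (1 - bbar)).
have dev_ge x : - 2^-1 <= dev x.
  (* Multiplying by [r] clears the [1 / r] in [B_test]. The [1] added to [M] in the choice of [d]
     absorbs [bbar * r <= 1]. *)
  have Br : - M - 1 <= (B_test B r x - bbar) * r.
    rewrite mulrBl; have : bbar * r <= 1 by nra.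
    suff : - M <= B_test B r x * r by lra.
    rewrite /B_test; case: ifP => _; last by rewrite mul0r; lra.
    rewrite -mulrA mulVf ?gt_eqF// mulr1.
    by have := BM (x.1, x.2.1); rewrite ler_norml => /andP[].
  have bM : beta * (2 * (M + 1)) <= (1 - bbar) * r.
    by move: beta_le; rewrite mulrAC ler_pdivlMr//; lra.
  rewrite /dev mulrA ler_pdivlMr// -(ler_pM2r r0) -[leRHS]mulrA.
  have := ler_wpM2l (ltW beta0) Br; lra.
have F_gt0 x : 0 < F_test B bbar r beta x.
  by rewrite mulr_gt0 ?powR_gt0// -/(dev x); have := dev_ge x; lra.
split; first by apply: F_test_PEF => // [|x]; [rewrite -subr_gt0|exact: ltW].
rewrite log_prob_rateE// lee_fin ler_pdivlMr//.
set s := rtimes _ _.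
have sP : is_distr s.
  by apply: rtimes_distr (nu_test_distr z0 r01') => zt; exact: rhoP.
have EB : Ex s (B_test B r) = bbar by rewrite Ex_B_test// hbbar.
pose k := beta / (1 - bbar).
(* This is [x - 2 x^2] at [x = k (B_r - bbar)], expanded in powers of [B_r] so that expectations can
   be taken term by term. *)
have lnF x : - (beta * ln (1 - bbar)) - k * bbar - 2 * k ^+ 2 * bbar ^+ 2
    + ((k + 4 * k ^+ 2 * bbar) * B_test B r x
       + - (2 * k ^+ 2) * B_test B r x ^+ 2) <= ln (F_test B bbar r beta x).
  rewrite lnM ?posrE ?powR_gt0//; last first.
    by rewrite -/(dev x); have := dev_ge x; lra.
  rewrite ln_powR; have := ln1Dx_ge (dev_ge x); rewrite /dev.
  suff -> : beta * ((B_test B r x - bbar) / (1 - bbar)) =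
    k * (B_test B r x - bbar) by nra.
  by rewrite /k; ring.
apply: le_trans (ler_Ex (fun x _ => lnF x)).
rewrite !ExD !ExZ !Ex_cst// EB.
have := Ex_B_test_sqr_le z0 rhoP r01 BM; rewrite -/s => EB2.
have -> : (- ln (1 - bbar) - 2 * M ^+ 2 / (1 - bbar) ^+ 2 * beta / r) * beta =
    - (beta * ln (1 - bbar)) - 2 * k ^+ 2 * (M ^+ 2 / r).
  by rewrite /k; field; rewrite !gt_eqF.
have k2 : 0 <= k ^+ 2 by exact: sqr_ge0.
(* In the mean the terms of first order in [k] cancel; besides the second moment there remains
   [2 k^2 bbar^2], which is nonnegative and is dropped. *)
have := ler_wpM2l k2 EB2; have := mulr_ge0 k2 (sqr_ge0 bbar); lra.
Qed.
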